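(* Let $A$ be a finite alphabet of size at least $2$, and let $k$ and $m$ be positive integers. Then the set of $A$-generated, $k$-relation monoid presentations which satisfy the small overlap condition $C(m)$ is exponentially generic with respect to the maximum length stratification.
   Context: An $A$-generated $k$-relation monoid presentation $\langle A \mid R\rangle$ consists of the finite alphabet $A$ and a finite sequence $R$ of $k$ ordered pairs of words $(u_1,v_1),\dots,(u_k,v_k) \in A^*\times A^*$. The words $u_1,v_1,\dots,u_k,v_k$ are the relation words; relation words at different positions count as different occurrences even if equal as words. A piece is a word which appears more than once as a factor (contiguous subword) in the relations, either as a factor of two different relation words, or as a factor of the same relation word in two different (possibly overlapping) places. The presentation satisfies $C(m)$ if no relation word can be written as a product of strictly fewer than $m$ pieces (the empty word being the product of zero pieces; so $C(1)$ says that no relation word is empty). The maximum length stratification of the set $S$ of $A$-generated $k$-relation presentations is the sequence $(S_n)$ where $S_n$ is the (finite) set of those presentations whose longest relation word has length exactly $n$. A subset $X \subseteq S$ is exponentially generic if $|X\cap S_n|/|S_n|$ converges to $1$ exponentially fast, i.e. there is $p\in(0,1)$ such that $1-|X\cap S_n|/|S_n| < p^n$ for all sufficiently large $n$. *)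

(* Defs.v *)
From mathcomp Require Import all_boot all_order all_algebra finmap.
From mathcomp Require Import boolp classical_sets functions cardinality reals.
Set Implicit Arguments.
Unset Strict Implicit.
Unset Printing Implicit Defensive.
Import Order.TTheory GRing.Theory Num.Theory.
Local Open Scope classical_set_scope.

Definition presentation (A : finType) (k : nat) : Type :=
  k.-tuple (seq A * seq A).

(* The 2k relation words are indexed by 'I_k * bool, so that equal words at
   different positions remain different occurrences. *)
Definition relword (A : finType) (k : nat) (P : presentation A k)
    (j : 'I_k * bool) : seq A :=
  let uv := tnth P j.1 in if j.2 then uv.2 else uv.1.

(* [occurs_at P w (j, i)]: w is a factor of the j-th relation word, starting
   at position i. *)
Definition occurs_at (A : finType) (k : nat) (P : presentation A k)
    (w : seq A) (o : ('I_k * bool) * nat) : Prop :=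
  exists x y : seq A, relword P o.1 = x ++ w ++ y /\ size x = o.2.

Definition piece (A : finType) (k : nat) (P : presentation A k)
    (w : seq A) : Prop :=
  exists o1 o2 : ('I_k * bool) * nat,
    [/\ o1 <> o2, occurs_at P w o1 & occurs_at P w o2].

(* The condition C(m). *)
Definition small_overlap (A : finType) (k m : nat)
    (P : presentation A k) : Prop :=
  forall (j : 'I_k * bool) (ps : seq (seq A)),
    (forall w, w \in ps -> piece P w) -> relword P j = flatten ps ->
    ~ (size ps < m)%N.

Definition max_length (A : finType) (k : nat) (P : presentation A k) : nat :=
  \max_(j : 'I_k * bool) size (relword P j).

Definition max_length_stratum (A : finType) (k n : nat) :
    set (presentation A k) :=
  [set P | max_length P = n].

(* [fset_set] is empty on infinite sets, so the next definition is meaningful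
   only for finite strata. *)
Lemma finite_max_length_stratum (A : finType) (k n : nat) :
  finite_set (@max_length_stratum A k n).
Proof.
pose bw := {bseq n of A}.
pose f (t : k.-tuple (bw * bw)) : presentation A k :=
  [tuple of map (fun p : bw * bw => (p.1 : seq A, p.2 : seq A)) t].
apply: (@sub_finite_set _ _ (f @` [set: k.-tuple (bw * bw)])); last first.
  exact/finite_image/finite_finset.
move=> P /= PE.
have le1 i : (size (tnth P i).1 <= n)%N.
  by rewrite -PE /max_length (leq_bigmax (i, false)).
have le2 i : (size (tnth P i).2 <= n)%N.
  by rewrite -PE /max_length (leq_bigmax (i, true)).
exists [tuple (Bseq (le1 i), Bseq (le2 i)) | i < k] => //.
apply: eq_from_tnth => i; rewrite tnth_map tnth_mktuple /=.
by case: (tnth P i).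
Qed.

Definition exponentially_generic (R : realType) (T : choiceType)
    (S : nat -> set T) (X : set T) : Prop :=
  exists2 p : R, (0 < p < 1)%R &
    exists N : nat, forall n : nat, (N <= n)%N ->
      (1 - (#|` fset_set (X `&` S n)|)%:R / (#|` fset_set (S n)|)%:R
         < p ^+ n)%R.

(* Main.v *)
Require Import Defs.
From mathcomp Require Import all_boot all_order all_algebra finmap.
From mathcomp Require Import boolp classical_sets functions cardinality reals.
From mathcomp Require Import zify ring lra.
Set Implicit Arguments.
Unset Strict Implicit.
Unset Printing Implicit Defensive.
Import Order.TTheory GRing.Theory Num.Theory.

(** Fix [n] and put [L = n %/ (2 * m)].  A relation word longer than [n/2] which
    is a product of fewer than [m] pieces involves a piece longer than [L],
    so a presentation in the [n]-th stratum violating C(m) either has a relation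
    word of length at most [n/2], or has a factor of length [L] occurring at two
    different places.  In the second case the later of the two occurrences can
    be deleted without losing information, even if they overlap.  Either way
    one relation word is encoded by a word of length at most [n - L], so
    the violating presentations form a proportion of the stratum which is
    at most [2 ^ - L] times a quadratic polynomial in [n]. *)

(** * Counting words, and deleting a repeated factor *)

Lemma card_ffun_at (I T : finType) (j : I) (D : {set T}) :
  #|[set f : {ffun I -> T} | f j \in D]| = #|D| * #|T| ^ #|I|.-1.
Proof.
pose F (i : I) : {pred T} := [pred x | (i == j) ==> (x \in D)].
have -> : #|[set f : {ffun I -> T} | f j \in D]|
    = #|(family F : simpl_pred {ffun I -> T})|.
  apply: eq_card => f; rewrite inE; apply/idP/familyP => [fj i | /(_ j)].
    by rewrite inE; apply/implyP => /eqP ->.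
  by rewrite inE eqxx.
rewrite card_family foldrE big_map big_enum /= (bigD1 j) //= /F.
congr (_ * _); first by apply: eq_card => x; rewrite inE eqxx.
rewrite (eq_bigr (fun _ => #|T|)) => [|i /negPf ij]; last first.
  by apply: eq_card => x; rewrite inE ij.
by rewrite prod_nat_const cardC1.
Qed.

Section Words.
Variable A : finType.
Hypothesis hA : 2 <= #|A|.

Lemma insub_bseqK (n : nat) (s : seq A) :
  size s <= n -> insub_bseq n s = s :> seq A.
Proof. by move=> h; rewrite /insub_bseq val_insubd h. Qed.

(** Geometric sum: since [2 <= #|A|], the bound [2 * #|A| ^ r] for lengths up to [r] is at most
    [#|A| ^ r.+1], the number of words of the next length. *)
Lemma card_bseq_size_le (n r : nat) :
  #|[set b : n.-bseq A | size b <= r]| <= 2 * #|A| ^ r.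
Proof.
have inj : {in [set b : n.-bseq A | size b <= r] &,
    injective (fun b : n.-bseq A => insub_bseq r b)}.
  move=> b c; rewrite !inE => hb hc /(congr1 val).
  by rewrite /= !insub_bseqK //; exact: val_inj.
rewrite -(card_in_imset inj); apply: leq_trans (max_card _) _.
rewrite card_bseq; elim: r {inj} => [|r IH]; first by rewrite big_ord1.
rewrite big_ord_recr /= expnS mulnA mul2n -addnn mulnDl leq_add2r.
by apply: leq_trans IH _; rewrite leq_mul2r hA orbT.
Qed.

Lemma card_bseq_size_eq_ge (n : nat) :
  #|A| ^ n <= #|[set b : n.-bseq A | size b == n]|.
Proof.
have inj : injective (@bseq_of_tuple n A).
  by move=> t u /(congr1 val) e; apply: val_inj.
rewrite -card_tuple -(card_imset _ inj).
apply/subset_leq_card/fintype.subsetP => _ /imsetP[t _ ->].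
by rewrite inE size_tuple.
Qed.

Definition delete (i L : nat) (w : seq A) := take i w ++ drop (i + L) w.

Lemma size_delete i L w : i + L <= size w -> size (delete i L w) = size w - L.
Proof.
move=> h; rewrite size_cat size_drop size_takel; last lia.
lia.
Qed.

Lemma eq_size_delete i L v w : i + L <= size v -> i + L <= size w ->
  delete i L v = delete i L w -> size v = size w.
Proof. by move=> hv hw /(congr1 size); rewrite !size_delete //; lia. Qed.

Lemma delete_nth x0 i L v w p : i + L <= size v -> i + L <= size w ->
  delete i L v = delete i L w -> (p < i) || (i + L <= p) ->
  nth x0 v p = nth x0 w p.
Proof.
move=> hv hw /eqP; have es : size (take i v) = size (take i w).
  by rewrite !size_takel; lia.
rewrite eqseq_cat // => /andP[/eqP et /eqP ed] /orP[hp | hp].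
  by rewrite -(nth_take x0 hp v) et nth_take.
by rewrite -(subnKC hp) -!nth_drop ed.
Qed.

Lemma eq_nth_factor (x0 : A) i1 i2 L v w p : i2 <= p -> p < i2 + L ->
  take L (drop i1 v) = take L (drop i2 w) ->
  nth x0 w p = nth x0 v (i1 + (p - i2)).
Proof.
move=> h1 h2 e; have hL : p - i2 < L by lia.
by rewrite -nth_drop -(nth_take x0 hL) e nth_take // nth_drop subnKC.
Qed.

(* If the letters of a word in positions [i, i+L) are copied from another
   word, or from earlier positions of the same word, they can be deleted
   without loss of information. *)
Lemma card_repeated_factor (I : finType) (n L : nat) (j1 j2 : I) (i1 i2 : nat) :
  (j1 != j2) || (i1 < i2) ->
  #|[set f : {ffun I -> n.-bseq A} | (i2 + L <= size (f j2)) &&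
       (take L (drop i1 (f j1)) == take L (drop i2 (f j2)))]|
    <= 2 * #|A| ^ (n - L) * #|{: n.-bseq A}| ^ #|I|.-1.
Proof.
move=> h12; set X := [set _ | _].
(* On [X] the shortened word has length at most [n], so [insub_bseq] never falls back on its default
   there. *)
pose del (f : {ffun I -> n.-bseq A}) :=
  [ffun j => if j == j2 then insub_bseq n (delete i2 L (f j2)) else f j].
have size_le (f : {ffun I -> n.-bseq A}) j : size (f j) <= n.
  exact: size_bseq.
have valdel f : f \in X -> del f j2 = delete i2 L (f j2) :> seq A.
  rewrite inE => /andP[h _]; rewrite ffunE eqxx insub_bseqK //.
  by rewrite size_delete //; have := size_le f j2; lia.
have inj : {in X &, injective del}.
  move=> f g fX gX e.
  have off j : j != j2 -> f j = g j.
    move=> hj; have := congr1 (fun u : {ffun I -> n.-bseq A} => u j) e.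
    by rewrite !ffunE (negPf hj).
  have ed : delete i2 L (f j2) = delete i2 L (g j2) by rewrite -!valdel // e.
  move: (fX) (gX); rewrite !inE => /andP[hf /eqP ef] /andP[hg /eqP eg].
  have es : size (f j2) = size (g j2).
    exact: eq_size_delete ed.
  apply/ffunP => j; have [->|/off //] := eqVneq j j2; apply: val_inj => /=.
  have /card_gt0P[x0 _] : 0 < #|A| by apply: ltnW.
  apply: (@eq_from_nth _ x0) => // p _.
  (* A deleted letter at [p] is a copy of the one at [i1 + (p - i2)], which is smaller than [p] when
     both places lie in one word; so strong induction copes with overlaps. Past the end both sides
     are the default [x0]. *)
  elim/ltn_ind: p => p IH.
  have [hp|] := boolP ((p < i2) || (i2 + L <= p)).
    exact: (delete_nth x0 hf hg).
  rewrite negb_or -leqNgt -ltnNge => /andP[h1 h2].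
  rewrite (eq_nth_factor x0 h1 h2 ef) (eq_nth_factor x0 h1 h2 eg).
  have [ej|/off -> //] := eqVneq j1 j2.
  rewrite ej; apply: IH.
  by move: h12; rewrite ej eqxx /=; lia.
rewrite -(card_in_imset inj).
apply: leq_trans (leq_mul (card_bseq_size_le n (n - L)) (leqnn _)).
rewrite -(card_ffun_at j2); apply/subset_leq_card/fintype.subsetP.
move=> _ /imsetP[f fX ->]; rewrite !inE valdel // size_delete.
  by rewrite leq_sub2r.
by move: fX; rewrite inE => /andP[].
Qed.

End Words.

(** * Counting the presentations that violate C(m) *)

Lemma card_exists_le (I T : finType) (P : pred I) (F : I -> {set T}) (c : nat) :
  (forall i, P i -> #|F i| <= c) ->
  #|[set x | [exists i, P i && (x \in F i)]]| <= #|I| * c.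
Proof.
move=> hF; have -> : [set x | [exists i, P i && (x \in F i)]]
    = (\bigcup_(i | P i) F i)%SET.
  apply/setP => x; rewrite inE; apply/existsP/finset.bigcupP.
    by case=> i /andP[]; exists i.
  by case=> i Pi xF; exists i; apply/andP.
have : #|(\bigcup_(i | P i) F i)%SET| <= \sum_(i | P i) #|F i|.
  elim/big_rec2: _ => [|i s X _ hX]; first by rewrite cards0.
  by apply: leq_trans (leq_card_setU _ _) _; rewrite leq_add2l.
move=> h; apply: leq_trans h _.
apply: leq_trans (leq_sum _ hF) _; rewrite sum_nat_const leq_mul2r.
by rewrite max_card orbT.
Qed.

Section Presentations.
Variables (A : finType) (k n : nat).

(** Codes in a finite type, so that fintype cardinals apply; they cover exactly the presentations
    with [max_length P <= n]. *)
Definition pres (f : {ffun 'I_k * bool -> n.-bseq A}) : presentation A k :=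
  [tuple (f (i, false) : seq A, f (i, true) : seq A) | i < k].

Lemma relword_pres f j : relword (pres f) j = f j.
Proof. by case: j => i []; rewrite /relword tnth_mktuple. Qed.

Lemma pres_inj : injective pres.
Proof.
move=> f g e; apply/ffunP => j; apply: val_inj => /=.
by rewrite -!relword_pres e.
Qed.

Lemma max_length_pres f : max_length (pres f) <= n.
Proof. by apply/bigmax_leqP => j _; rewrite relword_pres size_bseq. Qed.

Lemma pres_surj P : max_length P <= n -> exists f, P = pres f.
Proof.
move=> /bigmax_leqP h; exists [ffun j => insub_bseq n (relword P j)].
apply: eq_from_tnth => i; rewrite tnth_mktuple !ffunE.
by rewrite !insub_bseqK ?h // /relword /=; case: (tnth P i).
Qed.

Lemma occurs_at_factor (P : presentation A k) w j i L : occurs_at P w (j, i) ->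
  L <= size w ->
  i + L <= size (relword P j) /\ take L (drop i (relword P j)) = take L w.
Proof.
case=> x [y [/= -> <-]] hL; split; first by rewrite !size_cat; lia.
by rewrite drop_size_cat // takel_cat.
Qed.

Lemma not_small_overlap_factor m f : 0 < m -> ~ small_overlap m (pres f) ->
  (exists j, size (f j) <= n./2) \/
  exists o1 o2 : ('I_k * bool) * 'I_n.+1,
    let L := n %/ (2 * m) in
    [/\ (o1.1 != o2.1) || (o1.2 < o2.2), o2.2 + L <= size (f o2.1) &
        take L (drop o1.2 (f o1.1)) = take L (drop o2.2 (f o2.1))].
Proof.
move=> m0 hbad; apply: contrapT => H; apply: hbad => j ps hps e lt_ps.
set L := n %/ (2 * m) in H.
have long : n./2 < size (f j).
  by rewrite ltnNge; apply/negP => h; apply: H; left; exists j.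
have hL : m * L <= n./2.
  have := leq_divM n (2 * m); rewrite -/L; lia.
(* Otherwise the product has length at most [size ps * L <= m * L <= n./2], contradicting [long]. *)
have /hasP[w wps hw] : has (fun w => L < size w) ps.
  rewrite -[has _ _]negbK -all_predC; apply/negP => /allP hall.
  suff : size (flatten ps) <= size ps * L.
    by rewrite -e relword_pres; nia.
  elim: ps {hps e lt_ps} hall => //= w ps IH hall.
  rewrite size_cat mulSn leq_add //.
    by have := hall w (mem_head _ _); rewrite /= -leqNgt.
  by apply: IH => v hv; apply: hall; rewrite inE hv orbT.
(* Only the prefix of [w] of length [L] is kept. The place [(j2, i2)] is the one to delete, so the
   case analysis below puts the later occurrence second. *)
have key (j1 j2 : 'I_k * bool) (i1 i2 : nat) : (j1 != j2) || (i1 < i2) ->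
    occurs_at (pres f) w (j1, i1) -> ~ occurs_at (pres f) w (j2, i2).
  move=> h12 /occurs_at_factor - /(_ L (ltnW hw))[s1 e1].
  move=> /occurs_at_factor - /(_ L (ltnW hw))[s2 e2].
  move: s1 e1 s2 e2; rewrite !relword_pres => s1 e1 s2 e2.
  have b1 : i1 < n.+1 by have := size_bseq (f j1); lia.
  have b2 : i2 < n.+1 by have := size_bseq (f j2); lia.
  apply: H; right; exists (j1, Ordinal b1), (j2, Ordinal b2); split => //=.
  by rewrite e1 e2.
have [[j1 i1] [[j2 i2] [ne h1 h2]]] := hps w wps.
have [ej|nj] := eqVneq j1 j2; last by apply: (key j1 j2 i1 i2); rewrite ?nj.
case: (ltngtP i1 i2) => hi.
- by apply: (key j1 j2 i1 i2); rewrite ?hi ?orbT.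
- by apply: (key j2 j1 i2 i1); rewrite ?hi ?orbT.
- by apply: ne; rewrite ej hi.
Qed.

Definition stratum : {set {ffun 'I_k * bool -> n.-bseq A}} :=
  [set f | max_length (pres f) == n].

Hypotheses (hA : 2 <= #|A|) (hk : 0 < k).

(** It is enough to give one fixed relation word length exactly [n] and to leave the others free. *)
Lemma card_stratum_ge :
  #|A| ^ n * #|{: n.-bseq A}| ^ #|{: 'I_k * bool}|.-1 <= #|stratum|.
Proof.
pose j0 : 'I_k * bool := (Ordinal hk, false).
apply: leq_trans (leq_mul (card_bseq_size_eq_ge A n) (leqnn _)) _.
rewrite -(card_ffun_at j0); apply/subset_leq_card/fintype.subsetP => f.
rewrite !inE => /eqP h; rewrite eqn_leq max_length_pres /= -[X in X <= _]h.
by rewrite -relword_pres /max_length (leq_bigmax j0).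
Qed.

Lemma card_not_small_overlap_le m : 0 < m ->
  #|[set f in stratum | ~~ `[< small_overlap m (pres f) >]]|
      * 2 ^ (n %/ (2 * m))
    <= 16 * k ^ 2 * n.+1 ^ 2 * #|stratum|.
Proof.
move=> m0; set L := n %/ (2 * m); set bad := [set _ in _ | _].
set C := #|{: n.-bseq A}| ^ #|{: 'I_k * bool}|.-1.
have hL : L <= n by exact: leq_div.
have hL2 : n./2 <= n - L.
  by have := leq_divM n (2 * m); rewrite -/L; nia.
(* As [n./2 <= n - L], the same [B] serves for a given short relation word and for a given pair of
   places with equal factors. *)
pose B := 2 * #|A| ^ (n - L) * C.
pose short (j : 'I_k * bool) := [set f : {ffun 'I_k * bool -> n.-bseq A} |
  f j \in [set b : n.-bseq A | size b <= n./2]].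
pose O := (('I_k * bool) * 'I_n.+1)%type.
pose rep (o : O * O) := [set f : {ffun 'I_k * bool -> n.-bseq A} |
  (o.2.2 + L <= size (f o.2.1)) &&
  (take L (drop o.1.2 (f o.1.1)) == take L (drop o.2.2 (f o.2.1)))].
have cshort j : xpredT j -> #|short j| <= B.
  move=> _; rewrite card_ffun_at /B leq_mul2r; apply/orP; right.
  apply: leq_trans (card_bseq_size_le hA _ _) _.
  by rewrite leq_mul2l leq_pexp2l // ltnW.
have crep (o : O * O) : (o.1.1 != o.2.1) || (o.1.2 < o.2.2) -> #|rep o| <= B.
  exact: card_repeated_factor.
have hbad : #|bad| <= 2 * k * B + (2 * k * n.+1) ^ 2 * B.
  have := leq_add (card_exists_le cshort) (card_exists_le crep).
  rewrite !card_prod !card_ord card_bool [k * 2]mulnC -mulnn; apply: leq_trans.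
  apply: leq_trans (leq_card_setU _ _).
  apply/subset_leq_card/fintype.subsetP => f; rewrite !inE => /andP[_ /asboolP].
  move=> /(not_small_overlap_factor m0)[[j hj]|[o1 [o2 [h1 h2 h3]]]].
    by apply/orP; left; apply/existsP; exists j; rewrite !inE.
  apply/orP; right; apply/existsP; exists (o1, o2).
  by rewrite !inE h1 h2 h3 /=.
have hS := card_stratum_ge; rewrite -/C in hS.
(* Multiplying by [#|A| ^ L] restores the deleted letters and turns [B] into twice the lower bound
   for the stratum. *)
have hB : B * 2 ^ L <= 2 * #|stratum|.
  have h2 : 2 ^ L <= #|A| ^ L by case: (L) => // l; rewrite leq_exp2r.
  apply: leq_trans (leq_mul (leqnn B) h2) _.
  by rewrite /B -!mulnA [C * _]mulnC [_ ^ (n - L) * _]mulnA -expnD subnK //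
    leq_mul2l.
apply: leq_trans (leq_mul hbad (leqnn _)) _.
rewrite -mulnDl -mulnA; apply: leq_trans (leq_mul (leqnn _) hB) _.
rewrite mulnA leq_mul2r; apply/orP; right.
(* The factor is [2 * (2k + 4k^2 (n+1)^2)], and [4k <= 8k^2 (n+1)^2]. *)
rewrite -!mulnn; nia.
Qed.

End Presentations.

(** * Exponential decay beats the quadratic factor *)

Lemma quadratic_exp_lt (K : nat) :
  exists N, forall l, N <= l -> K * l ^ 2 * 2 ^ l < 3 ^ l.
Proof.
pose c := 2 ^ 7 * 7 ^ 3.
(* The shift by 7 makes the induction step work: [2 * (x + 1)^3 <= 3 * x^3] holds from [x = 7] on,
   as [1024 <= 1029]. *)
have cubic l : 2 ^ (l + 7) * (l + 7) ^ 3 <= c * 3 ^ (l + 7).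
  elim: l => [|l IH]; first exact: leq_pmulr.
  rewrite addSn !expnS; move: IH; rewrite !expnS expn0.
  move: (2 ^ _) (3 ^ _) => x y; nia.
(* The cubic bound has one factor [l] to spare, and [l > K * c] absorbs the constants. *)
exists (K * c + 8) => l hl.
have := cubic (l - 7); rewrite subnK; last lia.
rewrite -(@ltn_pmul2l c) //; apply: leq_trans.
have -> : c * (K * l ^ 2 * 2 ^ l) = K * c * (l ^ 2 * 2 ^ l) by rewrite /c; ring.
have -> : 2 ^ l * l ^ 3 = l * (l ^ 2 * 2 ^ l) by ring.
by rewrite ltn_mul2r muln_gt0 !expn_gt0; lia.
Qed.

Lemma quadratic_over_exp_lt (R : realType) (K M : nat) : 0 < M ->
  exists2 p : R, (0 < p < 1)%R & exists N : nat, forall n, N <= n ->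
    ((K * n.+1 ^ 2)%:R / (2 ^ (n %/ M))%:R < p ^+ n)%R.
Proof.
(* With [l = n %/ M + 1] and [n + 1 <= M * l], the bound by [(3 / 4) ^ l] follows from
   [2 * K * M ^ 2 * l ^ 2 * 2 ^ l < 3 ^ l]. *)
move=> M0; have [N hN] := quadratic_exp_lt (2 * K * M ^ 2).
have M1 : (1 <= M%:R :> R)%R by rewrite ler1n.
(* By Bernoulli's inequality this [t] gives [(1 - t) ^ M >= 3 / 4], whence
   [(1 - t) ^ n >= (3 / 4) ^ l]. *)
pose t : R := ((4 * M%:R)^-1)%R.
have t0 : (0 < t)%R by rewrite invr_gt0; lra.
have tM : (t * M%:R = 4^-1)%R by rewrite /t; field; lra.
have t1 : (t <= 4^-1)%R by rewrite -tM ler_peMr // ltW.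
exists (1 - t)%R; first by apply/andP; split; lra.
have q34 : (3 / 4 <= (1 - t) ^+ M)%R.
  suff H d : (1 - t * d%:R <= (1 - t) ^+ d)%R by have := H M; rewrite tM; lra.
  elim: d => [|d IH]; first by rewrite mulr0 subr0.
  rewrite exprS; have : ((1 - t) * (1 - t * d%:R) <= (1 - t) * (1 - t) ^+ d)%R.
    by rewrite ler_wpM2l //; lra.
  apply: le_trans; rewrite -natr1.
  have : (0 <= t * (t * d%:R))%R by rewrite !mulr_ge0 // ltW.
  lra.
exists (M * N) => n hn; set l := (n %/ M).+1.
have nl : n < M * l by rewrite /l mulnC -ltn_divLR.
have Nl : N <= l by rewrite ltnW // ltnS leq_divRL // mulnC.
have h2 : (0 < 2 ^+ (n %/ M) :> R)%R by rewrite exprn_gt0.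
apply: (@lt_le_trans _ _ ((3 / 4) ^+ l)%R); last first.
  apply: (@le_trans _ _ ((1 - t) ^+ (M * l))%R).
    by rewrite exprM lerXn2r // ?nnegrE //; lra.
  by rewrite ler_wiXn2l //; [lra|lra|exact: ltnW].
rewrite natrX ltr_pdivrMr //.
apply: (@le_lt_trans _ _ ((K * (M * l) ^ 2)%:R)%R).
  by rewrite ler_nat leq_mul2l leq_exp2r // nl orbT.
have -> : ((3 / 4) ^+ l * 2 ^+ (n %/ M) = 3 ^+ l / (2 * 2 ^+ l) :> R)%R.
  rewrite expr_div_n /l !exprS (_ : 4 = 2 * 2)%R; last by rewrite -natrM.
  by rewrite exprMn; field; rewrite lt0r_neq0.
rewrite ltr_pdivlMr; last by rewrite mulr_gt0 // exprn_gt0.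
rewrite -!natrX -!natrM ltr_nat.
by have := hN l Nl; rewrite !expnS expn0; congr (_ < _); ring.
Qed.

Local Open Scope classical_set_scope.

(** Moves both cardinals of the genericity ratio to the codes; the denominator is the case where [X]
    is the full set. *)
Lemma card_stratum_fset (A : finType) (k n : nat) (X : set (presentation A k)) :
  #|` fset_set (X `&` @max_length_stratum A k n)|
    = #|[set f in stratum A k n | `[< X (pres f) >]]%SET|.
Proof.
set D := [set f in _ | _]%SET.
have fin : finite_set (X `&` @max_length_stratum A k n).
  apply: sub_finite_set _ (@finite_max_length_stratum A k n).
  exact: subIsetr.
have -> : fset_set (X `&` @max_length_stratum A k n)
    = [fset pres f | f in D]%fset.
  apply/fsetP => P; rewrite in_fset_set //; apply/idP/imfsetP.
    rewrite inE => -[XP PE]; have PE' : max_length P = n := PE.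
    have [f fE] : exists f : {ffun 'I_k * bool -> n.-bseq A}, P = pres f.
      by apply: pres_surj; rewrite PE'.
    exists f => //; rewrite !inE -fE; apply/andP; split; last exact/asboolP.
    by rewrite PE'.
  move=> [f /=]; rewrite !inE => /andP[/eqP fn /asboolP Xf] ->.
  by split.
rewrite card_imfset //; last exact: pres_inj.
rewrite cardE; apply/perm_size/uniq_perm.
- exact: enum_finmem_uniq.
- exact: enum_uniq.
- by move=> f; rewrite enum_finmemE.
Qed.

Theorem theorem2 (R : realType) (A : finType) (k m : nat)
    (hA : (2 <= #|A|)%N) (hk : (0 < k)%N) (hm : (0 < m)%N) :
  @exponentially_generic R (presentation A k) (@max_length_stratum A k)
    [set P : presentation A k | small_overlap m P].
Proof.
have M0 : (0 < 2 * m)%N by rewrite muln_gt0.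
have [p p01 [N hN]] := quadratic_over_exp_lt R (16 * k ^ 2) M0.
exists p => //; exists N => n /hN; apply: le_lt_trans.
rewrite -[@max_length_stratum A k n as X in (_ / #|` fset_set X|%:R)%R]setTI.
rewrite !card_stratum_fset.
set S := stratum A k n.
have -> : [set f in S | `[< classical_sets.setT (pres f) >]]%SET = S.
  by apply/setP => f; rewrite inE asboolT ?andbT.
have bad := @card_not_small_overlap_le A k n hA hk m hm; rewrite -/S in bad.
(* A nonempty stratum makes the ratio a genuine quotient rather than a division by zero. *)
have S0 : (0 < #|S|)%N.
  apply: leq_trans _ (card_stratum_ge A n hk).
  rewrite muln_gt0 !expn_gt0 (ltnW hA) /=; apply/orP; left.
  by apply/card_gt0P; exists [bseq].
set G := [set f in S | `[< small_overlap m (pres f) >]]%SET.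
set B := [set f in S | _]%SET in bad.
have GB : (#|S| = #|G| + #|B|)%N.
  rewrite -(cardsID [set f | `[< small_overlap m (pres f) >]]%SET S).
  by congr (_ + _)%N; apply: eq_card => f; rewrite !inE // andbC.
have SR : (0 < #|S|%:R :> R)%R by rewrite ltr0n.
have -> : (1 - #|G|%:R / #|S|%:R = #|B|%:R / #|S|%:R :> R)%R.
  rewrite -[X in (X - _)%R](divff (lt0r_neq0 SR)) -mulrBl GB natrD.
  by rewrite addrAC subrr add0r.
rewrite ler_pdivrMr // mulrAC ler_pdivlMr ?ltr0n ?expn_gt0 //.
by rewrite -!natrM ler_nat.
Qed.
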